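(* Let $s,t,u,v$ be positive integers and let $\Gamma=\Gamma_{\mathbb R}(X^sY^t,X^uY^v)$. Then: \begin{enumerate} \item $\Gamma$ has girth four if and only if at least one of $s,t$ is even and at least one of $u,v$ is even. \item $\Gamma$ has girth six if and only if $\Gamma$ is isomorphic to one of $\Gamma_{\mathbb R}(X^{2j+1}Y^{2k+1},X^{2m+1}Y^{2n})$ with $j\neq m$ or $n\le k$, $\Gamma_{\mathbb R}(X^{2j}Y^{2k},X^{2m+1}Y^{2n+1})$, or $\Gamma_{\mathbb R}(X^{2j+1}Y^{2k+1},X^{2m+1}Y^{2n+1})$ (where $j,k,m,n$ are non-negative integers, and are positive whenever they occur in an even exponent). Equivalently, $\Gamma$ has girth six if and only if one of the following holds: (a) $s,t$ are even and $u,v$ are odd; (b) $s,t$ are odd and $u,v$ are even; (c) $s,t,u,v$ are all odd; (d) $s$ is even, $t,u,v$ are odd, and ($t\neq v$ or $s<u$); (e) $t$ is even, $s,u,v$ are odd, and ($s\neq u$ or $t<v$); (f) $u$ is even, $s,t,v$ are odd, and ($t\neq v$ or $u<s$); (g) $v$ is even, $s,t,u$ are odd, and ($s\neq u$ or $v<t$). \item $\Gamma$ has girth eight if and only if $\Gamma$ is isomorphic to $\Gamma_{\mathbb R}(XY^{2k+1},XY^{2n})$ for some integers $k\ge 0$, $n\ge 1$ with $n>k$. Equivalently, $\Gamma$ has girth eight if and only if one of the following holds: (a) $s$ is even, $t,u,v$ are odd, $t=v$ and $s>u$; (b) $t$ is even, $s,u,v$ are odd, $s=u$ and $t>v$; (c)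 $u$ is even, $s,t,v$ are odd, $t=v$ and $u>s$; (d) $v$ is even, $s,t,u$ are odd, $s=u$ and $v>t$. \end{enumerate}
   Context: For functions $f_2,f_3:\mathbb R^2\to\mathbb R$, the graph $\Gamma_{\mathbb R}(f_2,f_3)$ is the bipartite graph whose two partite sets are each a copy of $\mathbb R^3$; vertices of the first are written $(a_1,a_2,a_3)$ and of the second $[x_1,x_2,x_3]$, and $(a_1,a_2,a_3)$ is adjacent to $[x_1,x_2,x_3]$ if and only if $a_2+x_2=f_2(a_1,x_1)$ and $a_3+x_3=f_3(a_1,x_1)$. Here $X^sY^t$ denotes the function $(a,x)\mapsto a^s x^t$. The girth is the length of a shortest cycle. *)

(* Defs.v *)
From mathcomp Require Import all_boot all_order all_algebra.
From mathcomp Require Import reals.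

Set Implicit Arguments.
Unset Strict Implicit.
Unset Printing Implicit Defensive.

Import GRing.Theory.

(* A simple graph on V is a symmetric irreflexive e : rel V; V may be infinite. *)

(* [ucycle] by itself accepts any edge, traversed back and forth, as a closed
   sequence of two vertices; hence the requirement 2 < n. *)
Definition has_cycle_of_length (V : eqType) (e : rel V) (n : nat) : Prop :=
  2 < n /\ exists2 c : seq V, size c = n & ucycle e c.

Definition has_girth (V : eqType) (e : rel V) (n : nat) : Prop :=
  has_cycle_of_length e n /\ forall m, has_cycle_of_length e m -> n <= m.

Definition graph_iso (V W : eqType) (e : rel V) (e' : rel W) : Prop :=
  exists2 f : V -> W, bijective f & {mono f : x y / e x y >-> e' x y}.

(* [inl (a1, a2, a3)] is the vertex (a1, a2, a3) of the first partite set and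
   [inr (x1, x2, x3)] is the vertex [x1, x2, x3] of the second one. *)
Definition Gamma (R : realType) (f2 f3 : R -> R -> R) :
    rel ((R * R * R) + (R * R * R))%type :=
  fun p q => match p, q with
  | inl (a1, a2, a3), inr (x1, x2, x3)
  | inr (x1, x2, x3), inl (a1, a2, a3) =>
      (a2 + x2 == f2 a1 x1)%R && (a3 + x3 == f3 a1 x1)%R
  | _, _ => false
  end.

Definition monomial (R : realType) (s t : nat) : R -> R -> R :=
  fun a x => (a ^+ s * x ^+ t)%R.

Lemma Gamma_sym (R : realType) (f2 f3 : R -> R -> R) : symmetric (Gamma f2 f3).
Proof. by case=> [[[? ?] ?]|[[? ?] ?]] [[[? ?] ?]|[[? ?] ?]]. Qed.

Lemma Gamma_irrefl (R : realType) (f2 f3 : R -> R -> R) :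
  irreflexive (Gamma f2 f3).
Proof. by case=> [[[? ?] ?]|[[? ?] ?]]. Qed.

Definition monomial_graph (R : realType) (s t u v : nat) :
    rel ((R * R * R) + (R * R * R))%type :=
  Gamma (@monomial R s t) (@monomial R u v).
Arguments monomial_graph : clear implicits.

(* Main.v *)
Require Import Defs.
From mathcomp Require Import all_boot all_order all_algebra.
From mathcomp Require Import reals.
From mathcomp Require Import boolp ring lra zify.

(* In a closed walk the second and third coordinates can be eliminated: vertices
   with first coordinates a1, x1, a2, x2, ... close up iff the alternating sum
   of f(a1, x1) - f(a2, x1) + f(a2, x2) - ... vanishes for f = f2 and f = f3.
   For X^s Y^t the sum of a 4-cycle factors as (a^s - b^s)(x^t - y^t), and that
   of a 6-cycle vanishes iff the three points (a_i^s, x_i^t) are collinear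
   (after a cyclic relabelling of the x_i).  So 6-cycles are pairs of triples of
   distinct reals for which both (a_i^s, x_i^t) and (a_i^u, x_i^v) are collinear.

   If s = t and u = v modulo 2, the triples (-1, 0, 1) work.  Otherwise, swapping
   the two coordinates and the two sides, v is even and s, t, u are odd.  When
   s = u, both triples are collinear iff (x_i^t, x_i^v) are, and this curve is
   strictly convex for v > t but contains collinear triples for v < t.  When
   s <> u, take a = (0, b, 1): the collinearities say b^s = r and b^u = r', with
   r, r' the ratios in which x2 divides [x1, x3] after applying the powers t
   and v.  Along a path of triples x these ratios go from r' = 0 (antisymmetric
   x1, x2) to r = r' = 1/2 (all x_i close to 1), so r'^s - r^u changes sign, or
   does so for the reversed triple, depending on whether s < u. *)

Set Implicit Arguments.
Unset Strict Implicit.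
Unset Printing Implicit Defensive.

Import Order.TTheory GRing.Theory Num.Theory.
Local Open Scope ring_scope.

(** * Odd powers in ordered domains *)

Section OddPowers.
Variable R : realDomainType.
Implicit Types x y : R.

Lemma ltr_exp_odd n x y : odd n -> x < y -> x ^+ n < y ^+ n.
Proof.
move=> on lxy; have n0 : n != 0%N by case: n on.
have [x0|x0] := leP 0 x; first by rewrite ltrXn2r.
have [y0|y0] := leP 0 y.
  by apply: (@lt_le_trans _ _ 0); rewrite ?exprn_odd_lt0 ?exprn_odd_ge0.
have E z : (- z) ^+ n = - z ^+ n by rewrite exprNn -signr_odd on expr1 mulN1r.
by rewrite -ltrN2 -!E ltrXn2r ?oppr_ge0 ?ltrN2 // ltW.
Qed.

Lemma exprn_odd_inj n : odd n -> injective (fun x => x ^+ n).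
Proof.
move=> on x y /= e; apply/eqP; case: ltgtP => // /(ltr_exp_odd on);
by rewrite e ltxx.
Qed.

End OddPowers.

(** * Quotients of differences of powers *)

Section PowerSums.

(** The quotient of [x ^+ n - y ^+ n] by [x - y], in a form that keeps its meaning at [x = y], where
    ratios of such differences become 0/0. *)
Definition power_sum (A : comPzRingType) n (x y : A) : A :=
  \sum_(i < n) x ^+ (n.-1 - i) * y ^+ i.

Lemma horner_power_sum (R : comNzRingType) n (p q : {poly R}) c :
  (power_sum n p q).[c] = power_sum n p.[c] q.[c].
Proof.
by rewrite horner_sum; apply: eq_bigr => i _; rewrite hornerM !horner_exp.
Qed.

Lemma power_sum11 (A : comPzRingType) n : power_sum n (1 : A) 1 = n%:R.
Proof.
rewrite /power_sum; under eq_bigr do rewrite !expr1n mul1r.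
by rewrite sumr_const card_ord.
Qed.

Lemma subXX_power_sum (A : comPzRingType) n (x y : A) :
  x ^+ n - y ^+ n = (x - y) * power_sum n x y.
Proof. exact: subrXX. Qed.

Lemma sub1X_power_sum (A : comPzRingType) n (x : A) :
  1 - x ^+ n = (1 - x) * power_sum n 1 x.
Proof. by rewrite -subXX_power_sum expr1n. Qed.

Lemma power_sum_gt0 (R : realDomainType) n (x y : R) :
  y < x -> (0 < power_sum n x y) = (y ^+ n < x ^+ n).
Proof.
by move=> lyx; rewrite -[RHS]subr_gt0 subXX_power_sum pmulr_rgt0 // subr_gt0.
Qed.

Lemma power_sum_eq0 (R : idomainType) n (x y : R) :
  y != x -> (power_sum n x y == 0) = (x ^+ n == y ^+ n).
Proof.
move=> nyx; rewrite -[RHS]subr_eq0 subXX_power_sum mulf_eq0 subr_eq0 [x == y]eq_sym.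
by rewrite (negPf nyx).
Qed.

End PowerSums.

(** * Sign changes, convexity and collinearity on power curves *)

Section RealClosed.
Variable R : rcfType.

Lemma poly_sign_change (p : {poly R}) a b :
  a < b -> p.[a] * p.[b] < 0 -> exists2 c, a < c < b & p.[c] = 0.
Proof.
move=> lab; wlog pa : p / p.[a] < 0 => [W|] pab.
  have [pa|pa|e] := ltgtP p.[a] 0; first exact: W.
    have [||c hc] := W (- p).
    - by rewrite hornerN oppr_lt0.
    - by rewrite !hornerN mulrNN.
    by rewrite hornerN => /eqP; rewrite oppr_eq0 => /eqP; exists c.
  by rewrite e mul0r ltxx in pab.
have pb : 0 < p.[b] by rewrite -(nmulr_rlt0 _ pa).
have [|c /andP[ac cb] /rootP r] := @poly_ivt R p a b (ltW lab).
  by rewrite !ltW.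
exists c => //; rewrite !lt_neqAle ac cb !andbT.
by apply/andP; split; apply/eqP => e;
  [move: pa; rewrite e | move: pb; rewrite -e]; rewrite r ltxx.
Qed.

Lemma exprn_odd_surj n (y : R) : odd n -> exists x, x ^+ n = y.
Proof.
move=> on; have n0 : (0 < n)%N by case: n on.
pose b := `|y| + 1; have b1 : 1 <= b by rewrite lerDr.
have yb : `|y| < b by rewrite ltrDl.
have bb : b <= b ^+ n by apply: ler_eXnr.
have [||x _ /rootP] := @poly_ivt R ('X^n - y%:P) (- b) b.
- lra.
- rewrite !hornerE /= exprNn -signr_odd on expr1 mulN1r.
  by move: yb; rewrite ltr_norml => /andP[? ?]; lra.
by rewrite !hornerE => /eqP; rewrite subr_eq0 => /eqP; exists x.
Qed.

(** Tangent at 1; the induction step gains [n (y - 1)^2]. *)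
Lemma bernoulli_ge (y : R) n : 0 <= y -> n%:R * (y - 1) <= y ^+ n - 1.
Proof.
move=> y0; elim: n => [|n IH]; first by rewrite mul0r subrr.
rewrite exprS -natr1; have n0 : 0 <= n%:R :> R by [].
have := ler_wpM2l y0 IH; have := mulr_ge0 n0 (sqr_ge0 (y - 1)); lra.
Qed.

(** Tangent at [y], evaluated at 1. *)
Lemma bernoulli_le (y : R) n : 0 <= y ->
  y ^+ n - 1 <= n%:R * (y ^+ n.-1 * (y - 1)).
Proof.
move=> y0; case: n => [|n]; first by rewrite mul0r subrr.
elim: n => [|n IH] /=; first by rewrite expr0 expr1; lra.
have h : 0 <= (y - 1) * (y ^+ n.+1 - 1).
  rewrite subrX1 mulrA -expr2 mulr_ge0 ?sqr_ge0 //.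
  by apply: sumr_ge0 => i _; exact: exprn_ge0.
have := ler_wpM2l y0 IH; rewrite [y ^+ n.+2]exprS -[n.+2%:R]natr1.
move: h; rewrite /= [y ^+ n.+1]exprS; lra.
Qed.

(* Geometrically, the curve (x^t, x^v) lies strictly above its tangent at
   (c^t, c^v). *)
Lemma power_tangent_gt0 t v (c x : R) : odd t -> ~~ odd v -> (t < v)%N ->
  x != c -> 0 < t%:R * x ^+ v - v%:R * (c ^+ (v - t) * x ^+ t)
                + (v - t)%:R * c ^+ v.
Proof.
move=> ot ev tv xc; have t0 : (0 < t)%N by case: t ot {tv}.
have ovt : odd (v - t) by rewrite oddB ?ot ?(negPf ev) // ltnW.
have tR : 0 < t%:R :> R by rewrite ltr0n.
have vR : 0 < v%:R :> R by rewrite ltr0n; lia.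
have vtR : 0 < (v - t)%:R :> R by rewrite ltr0n; lia.
have xv := exprn_even_ge0 x ev; have cv := exprn_even_ge0 c ev.
(* Unless [c] and [x] have the same strict sign, every term is nonnegative and, as [x != c], one is
   positive. *)
have [cx|cx] := leP (c * x) 0.
  have h : c ^+ (v - t) * x ^+ t <= 0.
    have [c0|c0|c0] := ltgtP c 0.
    - rewrite nmulr_rle0 ?exprn_odd_lt0 // exprn_odd_ge0 //.
      by rewrite nmulr_rle0 in cx.
    - rewrite pmulr_rle0 ?exprn_odd_gt0 // exprn_odd_le0 //.
      by rewrite pmulr_rle0 in cx.
    by rewrite c0 expr0n subn_eq0 leqNgt tv mul0r.
  have : 0 < x ^+ v \/ 0 < c ^+ v.
    have [x0|x0] := eqVneq x 0; last by left; rewrite exprn_even_gt0 // x0 orbT.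
    by right; rewrite exprn_even_gt0 // -x0 [c == x]eq_sym xc orbT.
  have h2 : 0 <= t%:R * x ^+ v by rewrite mulr_ge0 // ltW.
  have h3 : 0 <= (v - t)%:R * c ^+ v by rewrite mulr_ge0 // ltW.
  have h4 : v%:R * (c ^+ (v - t) * x ^+ t) <= 0 by rewrite pmulr_rle0.
  case=> h'.
    have := mulr_gt0 tR h'; lra.
  have := mulr_gt0 vtR h'; lra.
have c0 : c != 0 by apply: contraTneq cx => ->; rewrite mul0r ltxx.
(* Dividing by [c ^+ v] leaves a function of [y > 0], which the two Bernoulli bounds keep above
   [t (v - t) y^(t-1) (y - 1)^2]. *)
pose y := x / c; have xE : x = y * c by rewrite divfK.
have y0 : 0 < y.
  rewrite -(pmulr_lgt0 _ (_ : 0 < c ^+ 2)) ?exprn_even_gt0 //.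
  by rewrite expr2 mulrA -xE mulrC.
have y1 : y - 1 != 0.
  by rewrite subr_eq0; apply: contra xc => /eqP e; rewrite xE e mul1r.
set m := (v - t)%N in vtR ovt *.
have vE : v = (m + t)%N by rewrite /m subnK // ltnW.
have cvp : 0 < c ^+ v by rewrite exprn_even_gt0 // c0 orbT.
have -> : t%:R * x ^+ v - v%:R * (c ^+ m * x ^+ t) + m%:R * c ^+ v =
   c ^+ v * (t%:R * (y ^+ t * (y ^+ m - 1)) - m%:R * (y ^+ t - 1)).
  by rewrite xE !exprMn vE !exprD natrD; ring.
rewrite mulr_gt0 //.
have /(ler_wpM2l (exprn_ge0 t (ltW y0)))/(ler_wpM2l (ltW tR)) :=
  bernoulli_ge m (ltW y0).
have /(ler_wpM2l (ltW vtR)) := bernoulli_le t (ltW y0).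
have := mulr_gt0 (mulr_gt0 tR vtR)
  (mulr_gt0 (exprn_gt0 t.-1 y0) (_ : 0 < (y - 1) ^+ 2)).
rewrite exprn_even_gt0 // => /(_ y1).
by rewrite -[in y ^+ t](prednK t0) [y ^+ t.-1.+1]exprS; lra.
Qed.

(** The two outer points lie strictly above the tangent at the middle one, hence so does their
    chord. Reordering the points only changes the sign of a determinant. *)
Lemma power_curve_not_collinear t v (x1 x2 x3 : R) :
  odd t -> ~~ odd v -> (t < v)%N -> x1 != x2 -> x2 != x3 -> x1 != x3 ->
  (x2 ^+ t - x1 ^+ t) * (x3 ^+ v - x1 ^+ v) !=
  (x3 ^+ t - x1 ^+ t) * (x2 ^+ v - x1 ^+ v).
Proof.
move=> ot ev tv.
have key (y1 y2 y3 : R) : y1 < y2 -> y2 < y3 ->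
   (y2 ^+ t - y1 ^+ t) * (y3 ^+ v - y1 ^+ v) >
   (y3 ^+ t - y1 ^+ t) * (y2 ^+ v - y1 ^+ v).
  move=> l12 l23.
  have t0 : (0 < t)%N by case: (t) ot.
  have tR : 0 < t%:R :> R by rewrite ltr0n.
  have n12 : y1 != y2 by rewrite lt_eqF.
  have n32 : y3 != y2 by rewrite gt_eqF.
  have := power_tangent_gt0 ot ev tv n12; have := power_tangent_gt0 ot ev tv n32.
  move: (ltr_exp_odd ot l12) (ltr_exp_odd ot l23).
  have -> : y2 ^+ v = y2 ^+ (v - t) * y2 ^+ t by rewrite -exprD subnK // ltnW.
  rewrite natrB ?(ltnW tv) //.
  move: (y2 ^+ (v - t)) (y1 ^+ t) (y2 ^+ t) (y3 ^+ t) (y1 ^+ v) (y3 ^+ v).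
  move=> K X1 X2 X3 Y1 Y3; rewrite -subr_gt0 => p1; rewrite -subr_gt0 => p2 h3 h1.
  rewrite -subr_gt0 -(pmulr_rgt0 _ tR).
  have := mulr_gt0 p1 h3; have := mulr_gt0 p2 h1; lra.
by case: (ltgtP x1 x2) => // l12; case: (ltgtP x2 x3) => // l23;
  case: (ltgtP x1 x3) => // l13 _ _ _; apply/eqP => e;
  do 1?[have := key _ _ _ l12 l23; lra | have := key _ _ _ l13 l23; lra
       |have := key _ _ _ l12 l13; lra | have := key _ _ _ l23 l12; lra
       |have := key _ _ _ l23 l13; lra | have := key _ _ _ l13 l12; lra
       |have := lt_trans l12 l23; lra | have := lt_trans l23 l12; lra].
Qed.

(** Restores the factors [d = 1 - y] and [d / 2] that the auxiliary polynomials [G] below have lost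
    by division; the powers of 2 account for the halves. *)
Lemma scaled_ratio (d A B C D : R) s u :
  A ^+ s * B ^+ u * 2%:R ^+ u = C ^+ u * D ^+ s * 2%:R ^+ s ->
  (d / 2%:R * A) ^+ s * (d * B) ^+ u = (d / 2%:R * C) ^+ u * (d * D) ^+ s.
Proof.
have n0 n : 2%:R ^+ n != 0 :> R by rewrite expf_neq0 // pnatr_eq0.
move=> e; rewrite !exprMn !exprVn.
transitivity (d ^+ s * d ^+ u / (2%:R ^+ s * 2%:R ^+ u)
              * (A ^+ s * B ^+ u * 2%:R ^+ u)); first by field; rewrite !n0.
by rewrite e; field; rewrite !n0.
Qed.

(** The equation is [r'^s = r^u] for the triple [y, z, 1]. At [y = -1/3] one has [r' = 0 < r]; as
    [y] tends to 1 both ratios tend to 1/2, where [s < u] gives the opposite sign. *)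
Lemma power_ratio_increasing s t u v : odd t -> ~~ odd v -> (0 < v)%N ->
  (0 < s)%N -> (s < u)%N ->
  exists2 y : R, - 3%:R^-1 < y < 1 & let z := (1 + y) / 2%:R in
    (z ^+ v - y ^+ v) ^+ s * (1 - y ^+ t) ^+ u =
    (z ^+ t - y ^+ t) ^+ u * (1 - y ^+ v) ^+ s.
Proof.
move=> ot ev v0 s0 su; have t0 : (0 < t)%N by case: (t) ot.
have tR : 0 < t%:R :> R by rewrite ltr0n.
have vR : 0 < v%:R :> R by rewrite ltr0n.
pose z : {poly R} := (1%:P + 'X) * (2%:R^-1)%:P.
(* [r'^s - r^u] with denominators cleared and powers of [1 - y] cancelled, so that its value at 1
   has a sign. *)
pose G : {poly R} :=
  (power_sum v z 'X) ^+ s * (power_sum t 1%:P 'X) ^+ u * (2%:R ^+ u)%:P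
  - (power_sum t z 'X) ^+ u * (power_sum v 1%:P 'X) ^+ s * (2%:R ^+ s)%:P.
have zE y : z.[y] = (1 + y) / 2%:R by rewrite !hornerE.
have GE y : G.[y] =
  power_sum v ((1 + y) / 2%:R) y ^+ s * power_sum t 1 y ^+ u * 2%:R ^+ u
  - power_sum t ((1 + y) / 2%:R) y ^+ u * power_sum v 1 y ^+ s * 2%:R ^+ s.
  by rewrite !hornerE !horner_power_sum zE !hornerE.
have [||y hy] := @poly_sign_change G (- 3%:R^-1) 1.
- lra.
- have -> : G.[1] = v%:R ^+ s * t%:R ^+ u * (2%:R ^+ u - 2%:R ^+ s).
    have e : (1 + 1) / 2%:R = 1 :> R by lra.
    by rewrite GE e !power_sum11; ring.
  rewrite nmulr_rlt0 ?mulr_gt0 ?exprn_gt0 // ?subr_gt0 ?ltr_eXn2l ?ltr1n //.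
  (* The midpoint of [-1/3] and 1 is the opposite point [1/3], which has the same even powers. *)
  rewrite GE; set z' := _ / 2%:R; have z'E : z' = 3%:R^-1 by rewrite /z'; field.
  have -> : power_sum v z' (- 3%:R^-1) = 0.
    apply/eqP; rewrite z'E power_sum_eq0; last by rewrite lt_eqF //; lra.
    by rewrite exprNn -signr_odd (negPf ev) mul1r.
  rewrite expr0n (gtn_eqF s0) !mul0r sub0r oppr_lt0 !mulr_gt0 ?exprn_gt0 //.
    by rewrite power_sum_gt0 ?z'E ?ltr_exp_odd //; lra.
  rewrite power_sum_gt0; last lra.
  rewrite exprNn -signr_odd (negPf ev) mul1r ltrXn2r ?invr_ge0 //; last lra.
  by rewrite -lt0n.
rewrite GE => e; exists y => // z'.
rewrite !sub1X_power_sum !subXX_power_sum.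
have -> : z' - y = (1 - y) / 2%:R by rewrite /z'; lra.
move/eqP: e; rewrite subr_eq0 => /eqP e.
exact: scaled_ratio.
Qed.

(** For the reversed triple [1, z, y], the value [y = -1/3] gives [r' = 1] and [0 < r < 1], and the
    limits 1/2 with [u < s] give the opposite sign. *)
Lemma power_ratio_decreasing s t u v : odd t -> ~~ odd v -> (0 < v)%N ->
  (0 < u)%N -> (u < s)%N ->
  exists2 y : R, - 3%:R^-1 < y < 1 & let z := (1 + y) / 2%:R in
    (1 - z ^+ v) ^+ s * (1 - y ^+ t) ^+ u =
    (1 - z ^+ t) ^+ u * (1 - y ^+ v) ^+ s.
Proof.
move=> ot ev v0 u0 us; have t0 : (0 < t)%N by case: (t) ot.
have tR : 0 < t%:R :> R by rewrite ltr0n.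
have vR : 0 < v%:R :> R by rewrite ltr0n.
pose z : {poly R} := (1%:P + 'X) * (2%:R^-1)%:P.
pose G : {poly R} :=
  (power_sum v 1%:P z) ^+ s * (power_sum t 1%:P 'X) ^+ u * (2%:R ^+ u)%:P
  - (power_sum t 1%:P z) ^+ u * (power_sum v 1%:P 'X) ^+ s * (2%:R ^+ s)%:P.
have zE y : z.[y] = (1 + y) / 2%:R by rewrite !hornerE.
have GE y : G.[y] =
  power_sum v 1 ((1 + y) / 2%:R) ^+ s * power_sum t 1 y ^+ u * 2%:R ^+ u
  - power_sum t 1 ((1 + y) / 2%:R) ^+ u * power_sum v 1 y ^+ s * 2%:R ^+ s.
  by rewrite !hornerE !horner_power_sum zE !hornerE.
have [||y hy] := @poly_sign_change G (- 3%:R^-1) 1.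
- lra.
- have -> : G.[1] = v%:R ^+ s * t%:R ^+ u * (2%:R ^+ u - 2%:R ^+ s).
    have e : (1 + 1) / 2%:R = 1 :> R by lra.
    by rewrite GE e !power_sum11; ring.
  rewrite pmulr_rlt0; last first.
    rewrite GE; set y' := - 3%:R^-1; set z' := _ / 2%:R.
    have z'E : z' = - y' by rewrite /z' /y'; lra.
    have ly : y' < 1 by rewrite /y'; lra.
    have lz : z' < 1 by rewrite /z' /y'; lra.
    have e n : power_sum n 1 z' = 2%:R / (1 - y') * (1 - z' ^+ n).
      rewrite sub1X_power_sum.
      have -> : 1 - z' = (1 - y') / 2%:R by rewrite /z'; lra.
      by field; rewrite subr_eq0 gt_eqF.
    have e' n : power_sum n 1 y' = 1 / (1 - y') * (1 - y' ^+ n).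
      by rewrite sub1X_power_sum; field; rewrite subr_eq0 gt_eqF.
    (* This is [r' = 1]: the even powers of [z' = - y'] and [y'] agree, and [1 - z'] is half of
       [1 - y']. *)
    have hv : power_sum v 1 z' = 2%:R * power_sum v 1 y'.
      by rewrite e e' z'E exprNn -signr_odd (negPf ev) mul1r; ring.
    have pv : 0 < power_sum v 1 y'.
      rewrite power_sum_gt0 // expr1n /y' exprNn -signr_odd (negPf ev) mul1r.
      by rewrite exprn_ilt1 // -?lt0n //; lra.
    have pt : power_sum t 1 z' < 2%:R * power_sum t 1 y'.
      rewrite e e' mulrA div1r ltr_pM2l ?divr_gt0 ?subr_gt0 // ltrD2l ltrN2.
      by rewrite ltr_exp_odd // z'E /y'; lra.
    have pz : 0 < power_sum t 1 z' by rewrite power_sum_gt0 // ltr_exp_odd.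
    set pu := power_sum t 1 z' in pt pz *; set pw := power_sum t 1 y' in pt *.
    have -> : (power_sum v 1 z') ^+ s * pw ^+ u * 2%:R ^+ u -
        pu ^+ u * power_sum v 1 y' ^+ s * 2%:R ^+ s =
        2%:R ^+ s * power_sum v 1 y' ^+ s * ((2%:R * pw) ^+ u - pu ^+ u).
      by rewrite hv !exprMn; ring.
    by rewrite !mulr_gt0 ?exprn_gt0 // subr_gt0 ltrXn2r ?ltW // -lt0n.
  by rewrite pmulr_rlt0 ?mulr_gt0 ?exprn_gt0 // subr_lt0 ltr_eXn2l ?ltr1n.
rewrite GE => e; exists y => // z'.
rewrite !sub1X_power_sum.
have -> : 1 - z' = (1 - y) / 2%:R by rewrite /z'; lra.
move/eqP: e; rewrite subr_eq0 => /eqP e.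
exact: scaled_ratio.
Qed.
Lemma power_curve_collinear t v : odd t -> ~~ odd v -> (0 < v < t)%N ->
  exists x1 x2 x3 : R, [/\ x1 < x2, x2 < x3 &
  (x2 ^+ t - x1 ^+ t) * (x3 ^+ v - x1 ^+ v) =
  (x3 ^+ t - x1 ^+ t) * (x2 ^+ v - x1 ^+ v)].
Proof.
move=> ot ev /andP[v0 vt].
(* The line through (-1, 1) of small positive slope 1/m meets the curve again
   twice on the right, since v / t < 1. *)
pose m : R := 2%:R ^+ t + 1; have m1 : 1 < m by rewrite ltrDr exprn_gt0.
have m0 : 0 < m by lra.
pose h : {poly R} := m *: ('X^v - 1%:P) - ('X^t + 1%:P).
have hE y : h.[y] = m * (y ^+ v - 1) - (y ^+ t + 1) by rewrite !hornerE.
have h1 : h.[1] < 0 by rewrite hE !expr1n; lra.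
(* By the choice of [m], this value is [m (2^v - 2)]. *)
have h2 : 0 < h.[2%:R].
  rewrite hE -/m.
  have : 2%:R ^+ 2 <= 2%:R ^+ v :> R.
    by rewrite ler_eXn2l ?ltr1n //; case: v v0 ev {vt h hE h1} => [|[|]].
  have -> : 2%:R ^+ 2 = 4%:R :> R by ring.
  move=> h4; have p : 0 < 2%:R ^+ v - 1 - 1 :> R by lra.
  by have := mulr_gt0 m0 p; lra.
have hm : h.[m] < 0.
  have : m ^+ v.+1 <= m ^+ t by rewrite ler_eXn2l.
  by rewrite hE exprS; lra.
have lm : 2%:R < m.
  have : 2%:R ^+ 1 <= 2%:R ^+ t :> R by rewrite ler_eXn2l ?ltr1n //; lia.
  by rewrite expr1 /m; lra.
have [||x /andP[x1 x2] hx] := @poly_sign_change h 1 2%:R; rewrite ?ltr1n //.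
  by rewrite nmulr_rlt0.
have [||y /andP[y1 y2] hy] := @poly_sign_change h 2%:R m; rewrite ?pmulr_rlt0 //.
exists (-1), x, y; split; [lra|lra|].
have e1 : (-1) ^+ v = 1 :> R by rewrite -signr_odd (negPf ev).
have e2 : (-1) ^+ t = -1 :> R by rewrite -signr_odd ot.
move: hx hy; rewrite !hE e1 e2.
have ex z : m * (z ^+ v - 1) - (z ^+ t + 1) = 0 ->
  z ^+ t - -1 = m * (z ^+ v - 1) by lra.
by move=> /ex -> /ex ->; ring.
Qed.

End RealClosed.

(** * Transport of cycles and girth along isomorphisms *)

Section GraphIso.

Lemma graph_iso_sym (V W : eqType) (e : rel V) (e' : rel W) :
  graph_iso e e' -> graph_iso e' e.
Proof.
case=> f [g fK gK] fe; exists g; first by exists f.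
by move=> x y; rewrite -fe !gK.
Qed.

Lemma graph_iso_trans (V W X : eqType) (e : rel V) (e' : rel W) (e'' : rel X) :
  graph_iso e e' -> graph_iso e' e'' -> graph_iso e e''.
Proof.
case=> f bf fe [g bg ge]; exists (g \o f); first exact: bij_comp.
by move=> x y /=; rewrite ge fe.
Qed.

Lemma graph_iso_cycle (V W : eqType) (e : rel V) (e' : rel W) n :
  graph_iso e e' -> has_cycle_of_length e n <-> has_cycle_of_length e' n.
Proof.
have H (V' W' : eqType) (d : rel V') (d' : rel W') :
    graph_iso d d' -> has_cycle_of_length d n -> has_cycle_of_length d' n.
  case=> f /bij_inj fi fe [n2 [c sc /andP[cc uc]]]; split=> //.
  exists (map f c); first by rewrite size_map.
  by rewrite /ucycle (mono_cycle fe) cc map_inj_uniq.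
by move=> i; split; apply: H => //; exact: graph_iso_sym.
Qed.

Lemma graph_iso_girth (V W : eqType) (e : rel V) (e' : rel W) n :
  graph_iso e e' -> has_girth e n -> has_girth e' n.
Proof.
move=> i [c m]; split; first by rewrite -(graph_iso_cycle n i).
by move=> k; rewrite -(graph_iso_cycle k i); exact: m.
Qed.

End GraphIso.

(** * Short cycles for arbitrary functions *)

Section GammaCycles.
Local Arguments Gamma : simpl never.
Variables (R : realType) (f g : R -> R -> R).
Let vertex := ((R * R * R) + (R * R * R))%type.
Let left_side (p : vertex) := if p is inl _ then true else false.
Let first_coord (p : vertex) := match p with inl a | inr a => a.1.1 end.

(** Every edge changes sides. *)
Lemma Gamma_cycle_even n : has_cycle_of_length (Gamma f g) n -> ~~ odd n.
Proof.
have side p q : Gamma f g p q -> left_side q = ~~ left_side p.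
  by case: p q => [[[? ?] ?]|[[? ?] ?]] [[[? ?] ?]|[[? ?] ?]].
have path_side p c : path (Gamma f g) p c ->
    left_side (last p c) = left_side p (+) odd (size c).
  elim: c p => [|q c IH] p /=; first by rewrite addbF.
  by case/andP=> /side e /IH ->; rewrite e addNb addbN.
case=> n2 [[|p c] sc] /andP[cc _]; first by rewrite -sc in n2.
have := path_side _ _ cc; rewrite last_rcons size_rcons -sc /=.
by case: (left_side p); case: (odd _).
Qed.

Lemma Gamma_cycle_left n : has_cycle_of_length (Gamma f g) n ->
  exists a c, (size c).+1 = n /\ ucycle (Gamma f g) (inl a :: c).
Proof.
case=> n2 [[|p [|q c]] sc uc]; try by rewrite -sc in n2.
case: p sc uc => [a|x] sc uc; first by exists a, (q :: c).
case: q sc uc => [a|y] sc uc.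
  exists a, (rcons c (inr x)); rewrite size_rcons; split=> //.
  have -> : inl a :: rcons c (inr x) = rot 1 [:: inr x, inl a & c].
    by rewrite /rot /= cats1.
  by rewrite rot_ucycle.
by move: uc; case: x sc => [[? ?] ?]; case: y => [[? ?] ?] ? /andP[].
Qed.

(** For building cycles: first coordinates that differ within each side suffice. *)
Lemma uniq_vertices (c : seq vertex) :
  uniq [seq (left_side p, first_coord p) | p <- c] -> uniq c.
Proof. exact: map_uniq. Qed.

(** A neighbour of [q] is determined by its first coordinate. *)
Lemma Gamma_first_coord p q r : Gamma f g p q -> Gamma f g q r -> p != r ->
  first_coord p != first_coord r.
Proof.
case: p q r => [[[p1 p2] p3]|[[p1 p2] p3]] [[[q1 q2] q3]|[[q1 q2] q3]] //;
case=> [[[r1 r2] r3]|[[r1 r2] r3]] //;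
rewrite /Gamma /= => /andP[/eqP e1 /eqP e2] /andP[/eqP e3 /eqP e4];
apply: contra => /eqP e; rewrite -e in e3 e4 *;
(have -> : r2 = p2 by lra); (have -> : r3 = p3 by lra); by [].
Qed.

Lemma Gamma_cycle4P : has_cycle_of_length (Gamma f g) 4 <->
  exists a b x y, [/\ a != b, x != y,
    f a x - f b x + f b y - f a y = 0 & g a x - g b x + g b y - g a y = 0].
Proof.
split.
  move/Gamma_cycle_left=> [[[a1 a2] a3] [[|p1 [|p2 [|p3 [|? ?]]]] [// _]]].
  rewrite /ucycle /=.
  case/andP=> /and5P[E1 E2 E3 E4 _]; rewrite !inE !negb_or.
  case/and4P=> /and3P[_ N1 _] /andP[_ N2] _ _.
  move: (Gamma_first_coord E1 E2 N1) (Gamma_first_coord E2 E3 N2).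
  case: p1 p2 p3 E1 E2 E3 E4 {N1 N2} => [[[? ?] ?]|[[x1 x2] x3]] //.
  case=> [[[b1 b2] b3]|[[? ?] ?]] // [[[? ?] ?]|[[y1 y2] y3]] //; rewrite /Gamma /=.
  move=> /andP[/eqP e1 /eqP e1'] /andP[/eqP e2 /eqP e2'].
  move=> /andP[/eqP e3 /eqP e3'] /andP[/eqP e4 /eqP e4'] nab nxy.
  by exists a1, b1, x1, y1; split=> //; lra.
case=> a [b [x [y [nab nxy ef eg]]]]; split=> //.
(* From [(a, 0, 0)] on, each edge forces the other coordinates of the next vertex; the vanishing
   sums give the closing edge. *)
pose q1 : vertex := inr (x, f a x, g a x).
pose p2 : vertex := inl (b, f b x - f a x, g b x - g a x).
pose q2 : vertex := inr (y, f b y - f b x + f a x, g b y - g b x + g a x).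
exists [:: inl (a, 0, 0); q1; p2; q2] => //; apply/andP; split.
  rewrite /= /Gamma /= andbT; apply/and4P; split; apply/andP; split; apply/eqP; lra.
by apply: uniq_vertices; rewrite /= !inE !xpair_eqE /= (negPf nab) (negPf nxy).
Qed.

(** In a hexagon any two vertices of one side are two steps apart, so their first coordinates
    differ. *)
Lemma Gamma_cycle6P : has_cycle_of_length (Gamma f g) 6 <->
  exists a b c x y z, [/\ [/\ a != b, b != c & a != c],
    [/\ x != y, y != z & x != z],
    f a x - f b x + f b y - f c y + f c z - f a z = 0 &
    g a x - g b x + g b y - g c y + g c z - g a z = 0].
Proof.
split.
  move/Gamma_cycle_left=> [[[a1 a2] a3] [[|p1 [|p2 [|p3 [|p4 [|p5 [|? ?]]]]]] [// _]]].
  rewrite /ucycle /=.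
  case/andP=> /and5P[E1 E2 E3 E4 /and3P[E5 E6 _]]; rewrite !inE !negb_or.
  case/and5P=> /and5P[_ N1 _ N2 _] /and4P[_ N3 _ N4] /and3P[_ N5 _] /andP[_ N6] _.
  move: (Gamma_first_coord E1 E2 N1) (Gamma_first_coord E2 E3 N3).
  move: (Gamma_first_coord E3 E4 N5) (Gamma_first_coord E4 E5 N6).
  rewrite eq_sym in N2; rewrite eq_sym in N4.
  move: (Gamma_first_coord E5 E6 N2) (Gamma_first_coord E6 E1 N4).
  move: p1 p2 p3 p4 p5 E1 E2 E3 E4 E5 E6 {N1 N2 N3 N4 N5 N6}.
  case=> [[[? ?] ?]|[[x1 x2] x3]] //.
  case=> [[[b1 b2] b3]|[[? ?] ?]] // [[[? ?] ?]|[[y1 y2] y3]] //.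
  case=> [[[c1 c2] c3]|[[? ?] ?]] // [[[? ?] ?]|[[z1 z2] z3]] //; rewrite /Gamma /=.
  move=> /andP[/eqP e1 /eqP e1'] /andP[/eqP e2 /eqP e2'].
  move=> /andP[/eqP e3 /eqP e3'] /andP[/eqP e4 /eqP e4'].
  move=> /andP[/eqP e5 /eqP e5'] /andP[/eqP e6 /eqP e6'] nca nzx nbc nyz nab nxy.
  exists a1, b1, c1, x1, y1, z1; split; [split=> // | split=> // | lra | lra];
  by rewrite eq_sym.
case=> a [b [c [x [y [z [[nab nbc nac] [nxy nyz nxz] ef eg]]]]]]; split=> //.
pose q1 : vertex := inr (x, f a x, g a x).
pose p2 : vertex := inl (b, f b x - f a x, g b x - g a x).
pose q2 : vertex := inr (y, f b y - f b x + f a x, g b y - g b x + g a x).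
pose p3 : vertex := inl (c, f c y - (f b y - f b x + f a x),
                            g c y - (g b y - g b x + g a x)).
(* Computed backwards from the first vertex; the vanishing sums give the edge between [p3] and
   [q3]. *)
pose q3 : vertex := inr (z, f a z, g a z).
exists [:: inl (a, 0, 0); q1; p2; q2; p3; q3] => //; apply/andP; split.
  by rewrite /= /Gamma /= andbT !andbA; repeat (apply/andP; split); apply/eqP; lra.
apply: uniq_vertices; rewrite /= !inE !xpair_eqE /=.
by rewrite (negPf nab) (negPf nbc) (negPf nac) (negPf nxy) (negPf nyz) (negPf nxz).
Qed.

(** Opposite vertices of an octagon may share their first coordinate, so this is only a
    construction, with distinctness assumed. *)
Lemma Gamma_cycle8 a b c d x y z w : uniq [:: a; b; c; d] -> uniq [:: x; y; z; w] ->
  f a x - f b x + f b y - f c y + f c z - f d z + f d w - f a w = 0 ->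
  g a x - g b x + g b y - g c y + g c z - g d z + g d w - g a w = 0 ->
  has_cycle_of_length (Gamma f g) 8.
Proof.
move=> ua ux ef eg; split=> //.
pose q1 : vertex := inr (x, f a x, g a x).
pose p2 : vertex := inl (b, f b x - f a x, g b x - g a x).
pose q2 : vertex := inr (y, f b y - f b x + f a x, g b y - g b x + g a x).
pose p3 : vertex := inl (c, f c y - (f b y - f b x + f a x),
                            g c y - (g b y - g b x + g a x)).
pose q3 : vertex := inr (z, f c z - f c y + (f b y - f b x + f a x),
                            g c z - g c y + (g b y - g b x + g a x)).
pose p4 : vertex := inl (d, f d w - f a w, g d w - g a w).
pose q4 : vertex := inr (w, f a w, g a w).
exists [:: inl (a, 0, 0); q1; p2; q2; p3; q3; p4; q4] => //; apply/andP; split.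
  by rewrite /= /Gamma /= andbT !andbA; repeat (apply/andP; split); apply/eqP; lra.
apply: uniq_vertices; move: ua ux; rewrite /= !inE !xpair_eqE /= !negb_or !andbT.
move=> /and3P[/and3P[n1 n2 n3] /andP[n4 n5] n6].
move=> /and3P[/and3P[m1 m2 m3] /andP[m4 m5] m6].
by rewrite n1 n2 n3 n4 n5 n6 m1 m2 m3 m4 m5 m6.
Qed.

Lemma Gamma_girth4 : has_girth (Gamma f g) 4 <-> has_cycle_of_length (Gamma f g) 4.
Proof.
split=> [[]|c4] //; split=> // m cm; have := Gamma_cycle_even cm; case: cm => m2 _.
by move: m m2 => [|[|[|[|]]]].
Qed.

Lemma Gamma_girth6 : has_girth (Gamma f g) 6 <->
  has_cycle_of_length (Gamma f g) 6 /\ ~ has_cycle_of_length (Gamma f g) 4.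
Proof.
split=> [[c6 h]|[c6 c4]]; first by split=> // /h.
split=> // m cm; have := Gamma_cycle_even cm; have [m2 _] := cm.
by move: m m2 cm => [|[|[|[|[|[|]]]]]].
Qed.

Lemma Gamma_girth8 : has_girth (Gamma f g) 8 <->
  [/\ has_cycle_of_length (Gamma f g) 8, ~ has_cycle_of_length (Gamma f g) 4
     & ~ has_cycle_of_length (Gamma f g) 6].
Proof.
split=> [[c8 h]|[c8 c4 c6]]; first by split=> // /h.
split=> // m cm; have := Gamma_cycle_even cm; have [m2 _] := cm.
by move: m m2 cm => [|[|[|[|[|[|[|[|]]]]]]]].
Qed.

End GammaCycles.

(** * Symmetries and short cycles of monomial graphs *)

Section MonomialGraph.
Variable R : realType.
Implicit Types s t u v : nat.
Let vertex := ((R * R * R) + (R * R * R))%type.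

Lemma monomial_graph_swap_coord s t u v :
  graph_iso (monomial_graph R s t u v) (monomial_graph R u v s t).
Proof.
pose sw (a : R * R * R) := (a.1.1, a.2, a.1.2).
pose F (p : vertex) : vertex :=
  match p with inl a => inl (sw a) | inr x => inr (sw x) end.
exists F; first by exists F; case=> [[[? ?] ?]|[[? ?] ?]].
by case=> [[[? ?] ?]|[[? ?] ?]] [[[? ?] ?]|[[? ?] ?]] //=; rewrite andbC.
Qed.

Lemma monomial_graph_swap_side s t u v :
  graph_iso (monomial_graph R s t u v) (monomial_graph R t s v u).
Proof.
pose F (p : vertex) : vertex := match p with inl a => inr a | inr x => inl x end.
exists F; first by exists F; case.
case=> [[[a1 a2] a3]|[[a1 a2] a3]] [[[x1 x2] x3]|[[x1 x2] x3]] //=;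
by rewrite /monomial [x2 + _]addrC [x3 + _]addrC ![x1 ^+ _ * _]mulrC.
Qed.

(** Both equations see the left coordinate [a] only through [a^s], and [a -> a^s] is a bijection for
    odd [s]. *)
Lemma monomial_graph_odd_root s t v : odd s ->
  graph_iso (monomial_graph R s t s v) (monomial_graph R 1 t 1 v).
Proof.
move=> os; have [r rK] := choice (fun y : R => exprn_odd_surj y os).
have Kr x : r (x ^+ s) = x by apply: (exprn_odd_inj os) => /=; rewrite rK.
pose F (p : vertex) : vertex :=
  if p is inl (a1, a2, a3) then inl (a1 ^+ s, a2, a3) else p.
pose G (p : vertex) : vertex :=
  if p is inl (a1, a2, a3) then inl (r a1, a2, a3) else p.
exists F; first by exists G; case=> [[[? ?] ?]|] //=; rewrite ?rK ?Kr.
by case=> [[[? ?] ?]|[[? ?] ?]] [[[? ?] ?]|[[? ?] ?]].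
Qed.

Lemma monomial_sum4_factor s t (a b x y : R) :
  a ^+ s * x ^+ t - b ^+ s * x ^+ t + b ^+ s * y ^+ t - a ^+ s * y ^+ t
  = (a ^+ s - b ^+ s) * (x ^+ t - y ^+ t).
Proof. by ring. Qed.

(** Odd powers are injective, so a factor vanishes only for an even exponent; conversely 1 and -1
    have equal even powers and serve both coordinates at once. *)
Lemma monomial_graph_cycle4 s t u v :
  has_cycle_of_length (monomial_graph R s t u v) 4 <->
  (~~ odd s \/ ~~ odd t) /\ (~~ odd u \/ ~~ odd v).
Proof.
rewrite Gamma_cycle4P /monomial; split.
  have ev m n (a b x y : R) : a != b -> x != y ->
      (a ^+ m - b ^+ m) * (x ^+ n - y ^+ n) = 0 -> ~~ odd m \/ ~~ odd n.
    move=> nab nxy /eqP; rewrite mulf_eq0 !subr_eq0.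
    case: (boolP (odd m)) => [om|]; last by left.
    case: (boolP (odd n)) => [on|]; last by right.
    rewrite (inj_eq (exprn_odd_inj om)) (inj_eq (exprn_odd_inj on)).
    by rewrite (negPf nab) (negPf nxy).
  case=> a [b [x [y [nab nxy]]]]; rewrite !monomial_sum4_factor => e1 e2.
  by split; [exact: ev e1 | exact: ev e2].
have ze m n : ~~ odd m \/ ~~ odd n ->
    (1 ^+ m - (-1) ^+ m) * (1 ^+ n - (-1) ^+ n) = 0 :> R.
  rewrite -!(signr_odd _ m) -!(signr_odd _ n) !expr1n.
  by case=> /negPf ->; rewrite expr0 subrr ?mulr0 ?mul0r.
have n1 : 1 != -1 :> R by rewrite gt_eqF //; lra.
case=> h1 h2; exists 1, (-1), 1, (-1).
by split=> //; rewrite monomial_sum4_factor ze.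
Qed.

(* Closing up a hexagon amounts to the collinearity of three points in each of
   the two coordinates. *)
Lemma monomial_graph_cycle6P s t u v :
  has_cycle_of_length (monomial_graph R s t u v) 6 <->
  exists a1 a2 a3 x1 x2 x3 : R, [/\ uniq [:: a1; a2; a3], uniq [:: x1; x2; x3],
    (a2 ^+ s - a1 ^+ s) * (x3 ^+ t - x1 ^+ t) =
    (a3 ^+ s - a1 ^+ s) * (x2 ^+ t - x1 ^+ t) &
    (a2 ^+ u - a1 ^+ u) * (x3 ^+ v - x1 ^+ v) =
    (a3 ^+ u - a1 ^+ u) * (x2 ^+ v - x1 ^+ v)].
Proof.
rewrite Gamma_cycle6P /monomial; split.
  case=> a [b [c [x [y [z [[nab nbc nac] [nxy nyz nxz] e1 e2]]]]]].
  (* Each left vertex is paired with the opposite vertex of the hexagon. *)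
  exists a, b, c, y, z, x; split; [| |lra|lra].
  - by rewrite /= !inE negb_or nab nac nbc.
  by rewrite /= !inE negb_or nyz [y == x]eq_sym nxy [z == x]eq_sym nxz.
case=> a [b [c [y [z [x [ua ux e1 e2]]]]]]; exists a, b, c, x, y, z.
move: ua ux; rewrite /= !inE !negb_or.
case/and3P=> /andP[nab nac] nbc _ /and3P[/andP[nyz nyx] nzx _].
by split; [split|split| |]; rewrite // 1?eq_sym //; lra.
Qed.

(** With -1, 0, 1 on both sides, equal parities put all points on the diagonal. *)
Lemma monomial_graph_cycle6_same_parity s t u v : (0 < s)%N -> (0 < t)%N ->
  (0 < u)%N -> (0 < v)%N -> odd s = odd t -> odd u = odd v ->
  has_cycle_of_length (monomial_graph R s t u v) 6.
Proof.
move=> s0 t0 u0 v0 st uv; apply/monomial_graph_cycle6P.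
have u3 : uniq [:: -1; 0; 1 : R].
  by rewrite /= !inE !negb_or !lt_eqF //=; lra.
have sg m n : odd m = odd n -> (-1) ^+ m = (-1) ^+ n :> R.
  by move=> e; rewrite -signr_odd e signr_odd.
exists (-1), 0, 1, (-1), 0, 1; split=> //;
by rewrite !expr0n !expr1n !gtn_eqF //= ?(sg _ _ st) ?(sg _ _ uv) mulrC.
Qed.

(** Takes [a = (0, b, 1)] with [b^s = r]; the hypothesis is [r'^s = r^u] without denominators. *)
Lemma monomial_graph_cycle6_of_ratio s t u v (x1 x2 x3 : R) : odd s -> odd t ->
  uniq [:: x1; x2; x3] -> x3 ^+ v != x1 ^+ v ->
  (x2 ^+ v - x1 ^+ v) ^+ s * (x3 ^+ t - x1 ^+ t) ^+ u =
  (x2 ^+ t - x1 ^+ t) ^+ u * (x3 ^+ v - x1 ^+ v) ^+ s ->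
  (0 < u)%N -> has_cycle_of_length (monomial_graph R s t u v) 6.
Proof.
move=> os ot ux nv e u0; apply/monomial_graph_cycle6P.
have s0 : (0 < s)%N by case: (s) os.
have nt x y : x != y -> x ^+ t - y ^+ t != 0 :> R.
  by rewrite subr_eq0 (inj_eq (exprn_odd_inj ot)).
have := ux; rewrite /= !inE negb_or => /and3P[/andP[n12 n13] n23 _].
have d1 : x3 ^+ t - x1 ^+ t != 0 by rewrite nt // eq_sym.
have d2 : x3 ^+ v - x1 ^+ v != 0 by rewrite subr_eq0.
have [b bs] := exprn_odd_surj ((x2 ^+ t - x1 ^+ t) / (x3 ^+ t - x1 ^+ t)) os.
have bu : b ^+ u = (x2 ^+ v - x1 ^+ v) / (x3 ^+ v - x1 ^+ v).
  (* [(b^u)^s = r^u = r'^s], and the odd power [s] can be cancelled. *)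
  apply: (exprn_odd_inj os) => /=; rewrite -exprM mulnC exprM bs !exprMn !exprVn.
  by apply/eqP; rewrite eqr_div ?expf_neq0 //; apply/eqP; rewrite e mulrC.
exists 0, b, 1, x1, x2, x3; split=> //.
- rewrite /= !inE negb_or !andbT eq_sym -(inj_eq (exprn_odd_inj os)) bs /=.
  rewrite expr0n (gtn_eqF s0) -[b == 1](inj_eq (exprn_odd_inj os)) bs expr1n.
  rewrite mulf_neq0 ?invr_eq0 ?nt 1?eq_sym //= oner_eq0 /=.
  apply: contra (nt _ _ n23) => /eqP h.
  by have := divfK d1 (x2 ^+ t - x1 ^+ t); rewrite h => ?; apply/eqP; lra.
- by rewrite bs !expr0n (gtn_eqF s0) expr1n !subr0 divfK // mul1r.
by rewrite bu !expr0n (gtn_eqF u0) expr1n !subr0 divfK // mul1r.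
Qed.

Lemma exprn_even_lt1 v (y : R) : ~~ odd v -> (0 < v)%N -> -1 < y < 1 -> y ^+ v < 1.
Proof.
move=> ev v0 y1; have -> : y ^+ v = `|y| ^+ v.
  by rewrite -normrX ger0_norm // exprn_even_ge0.
by rewrite exprn_ilt1 -?lt0n ?ltr_norml.
Qed.

Lemma monomial_graph_cycle6_one_even s t u v : odd s -> odd t -> odd u ->
  ~~ odd v -> (0 < v)%N -> s <> u \/ (v < t)%N ->
  has_cycle_of_length (monomial_graph R s t u v) 6.
Proof.
move=> os ot ou ev v0 h.
have s0 : (0 < s)%N by case: (s) os.
have t0 : (0 < t)%N by case: (t) ot.
have u0 : (0 < u)%N by case: (u) ou.
have dist (y : R) : - 3%:R^-1 < y < 1 ->
    uniq [:: y; (1 + y) / 2%:R; 1] && (y ^+ v != 1).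
  move=> /andP[y1 y2]; set z := _ / _; have h1 : y < z by rewrite /z; lra.
  have h2 : z < 1 by rewrite /z; lra.
  rewrite /= !inE !negb_or (lt_eqF h1) (lt_eqF h2) (lt_eqF y2) /=.
  by rewrite lt_eqF // exprn_even_lt1 //; apply/andP; split; lra.
have [su|us|su] := ltngtP s u.
- have [y hy e] := power_ratio_increasing R ot ev v0 s0 su.
  have /andP[un nv] := dist y hy.
  apply: (monomial_graph_cycle6_of_ratio os ot un); rewrite ?expr1n //.
  by rewrite eq_sym.
- have [y hy e] := power_ratio_decreasing R ot ev v0 u0 us.
  have /andP[un nv] := dist y hy.
  rewrite -rev_uniq in un.
  apply: (monomial_graph_cycle6_of_ratio os ot un); rewrite ?expr1n //.
  (* In the reversed triple every difference changes sign; [s] and [u] are odd, so the signs cancel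
     on each side. *)
  have N n (x : R) : odd n -> (x - 1) ^+ n = - (1 - x) ^+ n.
    by move=> on; rewrite -opprB exprNn -signr_odd on expr1 mulN1r.
  by rewrite !N // !mulrNN.
rewrite {}su in h *; case: h => // vt.
(* For [s = u], the choice [a_i = b_i^t], [x_i = b_i^u] puts the first triple on the diagonal and
   the second on the curve with exponents [u t] and [u v]. *)
have [|||b1 [b2 [b3 [l12 l23 e]]]] := @power_curve_collinear R (u * t) (u * v).
- by rewrite oddM ou.
- by rewrite oddM ou.
- by rewrite muln_gt0 u0 v0 ltn_pmul2l.
apply/monomial_graph_cycle6P.
exists (b1 ^+ t), (b2 ^+ t), (b3 ^+ t), (b1 ^+ u), (b2 ^+ u), (b3 ^+ u).
have un n : odd n -> uniq [:: b1 ^+ n; b2 ^+ n; b3 ^+ n].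
  move=> on; rewrite /= !inE !negb_or !(inj_eq (exprn_odd_inj on)).
  by rewrite !lt_eqF // (lt_trans l12).
by split; rewrite ?un // -!exprM ![(t * u)%N]mulnC // mulrC.
Qed.

(** Both collinearities involve the same [a_i^s]; eliminating these makes the points
    [(x_i^t, x_i^v)] collinear, against convexity. *)
Lemma monomial_graph_no_cycle6 s t v : odd s -> odd t -> ~~ odd v ->
  (t < v)%N -> ~ has_cycle_of_length (monomial_graph R s t s v) 6.
Proof.
move=> os ot ev tv /monomial_graph_cycle6P[a1 [a2 [a3 [x1 [x2 [x3 [ua ux]]]]]]].
move: ua ux; rewrite /= !inE !negb_or !andbT.
move=> /andP[/andP[n12 n13] _] /andP[/andP[m12 m13] m23].
have {}n12 : a2 ^+ s - a1 ^+ s != 0.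
  by rewrite subr_eq0 (inj_eq (exprn_odd_inj os)) eq_sym.
move: (power_curve_not_collinear ot ev tv m12 m23 m13) n12.
move: (a1 ^+ s) (a2 ^+ s) (a3 ^+ s) => A1 A2 A3.
move: (x1 ^+ t) (x2 ^+ t) (x3 ^+ t) (x1 ^+ v) (x2 ^+ v) (x3 ^+ v).
move=> X1 X2 X3 Y1 Y2 Y3 /eqP nc n12 e1 e2; apply: nc.
apply: (mulfI n12).
transitivity (((A2 - A1) * (Y3 - Y1)) * (X2 - X1)); first by ring.
rewrite e2; transitivity (((A3 - A1) * (X2 - X1)) * (Y2 - Y1)); first by ring.
by rewrite -e1; ring.
Qed.

(** Once [s] is replaced by 1, the closing conditions are linear in the left coordinates. *)
Lemma monomial_graph_cycle8 s t v : odd s -> odd t -> ~~ odd v -> (0 < v)%N ->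
  has_cycle_of_length (monomial_graph R s t s v) 8.
Proof.
move=> os ot ev v0.
rewrite (graph_iso_cycle 8 (monomial_graph_odd_root t v os)).
have t0 : (0 < t)%N by case: (t) ot.
pose p : R := 3%:R ^+ t; pose q : R := 3%:R ^+ v.
have p0 : 0 < p by rewrite exprn_gt0.
have q9 : 9%:R <= q.
  have -> : 9%:R = 3%:R ^+ 2 :> R by ring.
  by rewrite ler_eXn2l ?ltr1n //; case: v v0 ev {q} => [|[|]].
have npq : p != q.
  rewrite /p /q -!natrX eqr_nat eqn_exp2l //; by apply: contraNneq ev => <-.
(* The two sides differ modulo 3. *)
have npq2 : p + 2%:R != q.
  rewrite /p /q -!natrX -natrD eqr_nat -(prednK t0) -(prednK v0) !expnS.
  by apply/eqP; lia.
have e1 : (-1) ^+ v = 1 :> R by rewrite -signr_odd (negPf ev).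
have e2 : (-1) ^+ t = -1 :> R by rewrite -signr_odd ot.
(* For right coordinates [0, 1, -1, 3] and left ones [0, b, c, 2], the conditions are
   [b - 2 c + 2 (1 + p) = 0] and [b + 2 (q - 1) = 0]. *)
apply: (@Gamma_cycle8 _ _ _ 0 (2%:R - 2%:R * q) (p + 2%:R - q) 2%:R 0 1 (-1) 3%:R).
- rewrite /= !inE !negb_or !andbT -!andbA; apply/and5P; split.
  + by apply/eqP; lra.
  + by apply: contra npq2 => /eqP h; apply/eqP; lra.
  + by apply/eqP; lra.
  + by apply/eqP; lra.
  apply/andP; split; first by apply/eqP; lra.
  by apply: contra npq => /eqP h; apply/eqP; lra.
- rewrite /= !inE !negb_or !andbT -!andbA.
  by repeat (apply/andP; split); apply/eqP; lra.
- by rewrite /monomial !expr1 e2 expr1n expr0n (gtn_eqF t0) -/p /=; ring.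
by rewrite /monomial !expr1 e1 expr1n expr0n (gtn_eqF v0) -/q /=; ring.
Qed.

End MonomialGraph.

Local Close Scope ring_scope.

(** * Parity patterns of the exponents *)

Definition girth6_exponents (s t u v : nat) : Prop :=
      [/\ ~~ odd s, ~~ odd t, odd u & odd v]
      \/ [/\ odd s, odd t, ~~ odd u & ~~ odd v]
      \/ [/\ odd s, odd t, odd u & odd v]
      \/ [/\ ~~ odd s, odd t, odd u, odd v & t <> v \/ s < u]
      \/ [/\ ~~ odd t, odd s, odd u, odd v & s <> u \/ t < v]
      \/ [/\ ~~ odd u, odd s, odd t, odd v & t <> v \/ u < s]
      \/ [/\ ~~ odd v, odd s, odd t, odd u & s <> u \/ v < t].

Definition girth8_exponents (s t u v : nat) : Prop :=
      ([/\ ~~ odd s, odd t, odd u & odd v] /\ t = v /\ u < s)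
      \/ ([/\ ~~ odd t, odd s, odd u & odd v] /\ s = u /\ v < t)
      \/ ([/\ ~~ odd u, odd s, odd t & odd v] /\ t = v /\ s < u)
      \/ ([/\ ~~ odd v, odd s, odd t & odd u] /\ s = u /\ t < v).

(** With a single even exponent, the two exponents compared have opposite parity, so they cannot be
    equal. *)
Lemma exponents_trichotomy s t u v :
  ~ ((~~ odd s \/ ~~ odd t) /\ (~~ odd u \/ ~~ odd v)) ->
  girth6_exponents s t u v \/ girth8_exponents s t u v.
Proof.
have cmp (a b c d : nat) : odd c -> ~~ odd d ->
    (a <> b \/ d < c) \/ (a = b /\ c < d).
  move=> oc ed; have [->|/eqP n] := eqVneq a b; last by left; left.
  have [?|?|e] := ltngtP c d; [by right | by left; right |].
  by rewrite -e oc in ed.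
rewrite /girth6_exponents /girth8_exponents.
case: (boolP (odd s)) => os; case: (boolP (odd t)) => ot;
case: (boolP (odd u)) => ou; case: (boolP (odd v)) => ov H;
  try (by exfalso; apply: H; split; [by [left | right] | by [left | right]]).
- by left; right; right; left.
- by case: (cmp s u t v) => // h; [left; do 6 right | right; do 3 right].
- by case: (cmp t v s u) => // h; [left; do 5 right; left | right; do 2 right; left].
- by left; right; left.
- by case: (cmp s u v t) => // h; [left; do 4 right; left | right; right; left].
- by case: (cmp t v u s) => // h; [left; do 3 right; left | right; left].
by left; left.
Qed.

Lemma girth6_exponents_no_cycle4 s t u v : girth6_exponents s t u v ->
  ~ ((~~ odd s \/ ~~ odd t) /\ (~~ odd u \/ ~~ odd v)).
Proof.
move=> h [h1 h2]; case: h =>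
  [[]|[[]|[[]|[[]|[[]|[[]|[]]]]]]] *;
by case: h1 => /negP ?; case: h2 => /negP ?.
Qed.
Lemma girth8_exponents_no_cycle4 s t u v : girth8_exponents s t u v ->
  ~ ((~~ odd s \/ ~~ odd t) /\ (~~ odd u \/ ~~ odd v)).
Proof.
move=> h [h1 h2]; case: h =>
  [[[] ? ? ? ? _]|[[[] ? ? ? ? _]|[[[] ? ? ? ? _]|[[] ? ? ? ? _]]]];
by case: h1 => /negP ?; case: h2 => /negP ?.
Qed.

Lemma half_odd n : odd n -> (2 * n./2 + 1)%N = n.
Proof. by move=> on; rewrite -[RHS](odd_double_half n) on mul2n addnC. Qed.

Lemma half_even n : ~~ odd n -> (2 * n./2)%N = n.
Proof. by move=> /negPf en; rewrite -[RHS](odd_double_half n) en mul2n. Qed.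

(** * Normal forms and classification by girth *)

Section Classification.
Variable R : realType.
Implicit Types s t u v : nat.

Lemma monomial_graph_swap_both s t u v :
  graph_iso (monomial_graph R s t u v) (monomial_graph R v u t s).
Proof.
exact: graph_iso_trans (monomial_graph_swap_coord _ _ _ _ _)
                       (monomial_graph_swap_side _ _ _ _ _).
Qed.

(** Swapping coordinates and sides moves a single even exponent to the last place, or an even pair
    to the first two. *)
Lemma girth6_exponents_iso s t u v : 0 < s -> 0 < t -> 0 < u -> 0 < v ->
  girth6_exponents s t u v ->
  (exists j k m n, 0 < n /\ (j <> m \/ n <= k) /\
     graph_iso (monomial_graph R s t u v)
       (monomial_graph R (2 * j + 1) (2 * k + 1) (2 * m + 1) (2 * n)))
  \/ (exists j k m n, 0 < j /\ 0 < k /\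
     graph_iso (monomial_graph R s t u v)
       (monomial_graph R (2 * j) (2 * k) (2 * m + 1) (2 * n + 1)))
  \/ (exists j k m n,
     graph_iso (monomial_graph R s t u v)
       (monomial_graph R (2 * j + 1) (2 * k + 1) (2 * m + 1) (2 * n + 1))).
Proof.
move=> s0 t0 u0 v0.
have pos n : 0 < n -> ~~ odd n -> 0 < n./2 by case: n => [|[|]].
have id_iso : graph_iso (monomial_graph R s t u v) (monomial_graph R s t u v).
  by exists id => //; exists id.
have last_even s' t' u' v' : odd s' -> odd t' -> odd u' -> ~~ odd v' -> 0 < v' ->
    s' <> u' \/ v' < t' ->
    graph_iso (monomial_graph R s t u v) (monomial_graph R s' t' u' v') ->
    exists j k m n, 0 < n /\ (j <> m \/ n <= k) /\
      graph_iso (monomial_graph R s t u v)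
        (monomial_graph R (2 * j + 1) (2 * k + 1) (2 * m + 1) (2 * n)).
  move=> os ot ou ev v0' h i; exists s'./2, t'./2, u'./2, v'./2.
  rewrite !half_odd // half_even //; split; first exact: pos.
  split=> //; case: h => [n|]; last by right; lia.
  by left=> e; apply: n; move: (half_odd os) (half_odd ou); rewrite e => -> ->.
case=> [[? ? ? ?]|[[? ? ? ?]|[[? ? ? ?]|[[? ? ? ? ?]|[[? ? ? ? ?]|[[? ? ? ? ?]|[? ? ? ? ?]]]]]]].
- right; left; exists s./2, t./2, u./2, v./2.
  by rewrite !half_odd // !half_even // !pos.
- right; left; exists u./2, v./2, s./2, t./2.
  rewrite !half_odd // !half_even // !pos //; do 2 split=> //.
  exact: monomial_graph_swap_coord.
- by right; right; exists s./2, t./2, u./2, v./2; rewrite !half_odd.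
- left; apply: (last_even v u t s) => //; last exact: monomial_graph_swap_both.
  by lia.
- left; apply: (last_even u v s t) => //; last exact: monomial_graph_swap_coord.
  by lia.
- by left; apply: (last_even t s v u) => //; exact: monomial_graph_swap_side.
by left; apply: (last_even s t u v).
Qed.

Lemma girth6_exponents_cycle6 s t u v : 0 < s -> 0 < t -> 0 < u -> 0 < v ->
  girth6_exponents s t u v -> has_cycle_of_length (monomial_graph R s t u v) 6.
Proof.
move=> s0 t0 u0 v0 /(girth6_exponents_iso s0 t0 u0 v0).
case=> [[j [k [m [n [n0 [h i]]]]]]|[[j [k [m [n [j0 [k0 i]]]]]]|[j [k [m [n i]]]]]];
rewrite (graph_iso_cycle 6 i).
- by apply: monomial_graph_cycle6_one_even; lia.
- by apply: monomial_graph_cycle6_same_parity; lia.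
by apply: monomial_graph_cycle6_same_parity; lia.
Qed.

Lemma girth8_exponents_iso s t u v : girth8_exponents s t u v ->
  exists s' t' v', [/\ odd s', odd t', ~~ odd v', t' < v' &
    graph_iso (monomial_graph R s t u v) (monomial_graph R s' t' s' v')].
Proof.
case=> [[[? ? ? ?] [e ?]]|[[[? ? ? ?] [e ?]]|[[[? ? ? ?] [e ?]]|[[? ? ? ?] [e ?]]]]].
- by exists v, u, s; split=> //; rewrite e; exact: monomial_graph_swap_both.
- by exists u, v, t; split=> //; rewrite e; exact: monomial_graph_swap_coord.
- by exists t, s, u; split=> //; rewrite -e; exact: monomial_graph_swap_side.
by exists s, t, v; split=> //; rewrite -e; exists id => //; exists id.
Qed.

(** Without 4-cycles two exponent patterns remain, and the second excludes hexagons. *)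
Lemma monomial_graph_girth6 s t u v : 0 < s -> 0 < t -> 0 < u -> 0 < v ->
  has_girth (monomial_graph R s t u v) 6 <-> girth6_exponents s t u v.
Proof.
move=> s0 t0 u0 v0; rewrite Gamma_girth6 monomial_graph_cycle4; split.
  case=> c6 /exponents_trichotomy[//|/girth8_exponents_iso].
  move=> [s' [t' [v' [os ot ev tv i]]]].
  by case: (@monomial_graph_no_cycle6 R _ _ _ os ot ev tv);
  rewrite -(graph_iso_cycle 6 i).
move=> h; split; first exact: girth6_exponents_cycle6.
exact: girth6_exponents_no_cycle4.
Qed.

Lemma monomial_graph_girth8 s t u v : 0 < s -> 0 < t -> 0 < u -> 0 < v ->
  has_girth (monomial_graph R s t u v) 8 <-> girth8_exponents s t u v.
Proof.
move=> s0 t0 u0 v0; rewrite Gamma_girth8; split.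
  case=> _; rewrite monomial_graph_cycle4 => /exponents_trichotomy[].
    by move=> /(girth6_exponents_cycle6 s0 t0 u0 v0).
  by [].
move=> h; have n4 := girth8_exponents_no_cycle4 h.
have [s' [t' [v' [os ot ev tv i]]]] := girth8_exponents_iso h.
split; rewrite ?monomial_graph_cycle4 ?(graph_iso_cycle _ i) //;
  last exact: monomial_graph_no_cycle6.
by apply: monomial_graph_cycle8 => //; lia.
Qed.

End Classification.

Theorem theorem1 (R : realType) (s t u v : nat)
    (hs : 0 < s) (ht : 0 < t) (hu : 0 < u) (hv : 0 < v) :
  let G := monomial_graph R s t u v in
  (has_girth G 4 <-> (~~ odd s \/ ~~ odd t) /\ (~~ odd u \/ ~~ odd v))
  /\
  ((has_girth G 6 <->
      (exists j k m n : nat, 0 < n /\ (j <> m \/ n <= k) /\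
         graph_iso G (monomial_graph R (2 * j + 1) (2 * k + 1)
                                       (2 * m + 1) (2 * n)))
      \/ (exists j k m n : nat, 0 < j /\ 0 < k /\
         graph_iso G (monomial_graph R (2 * j) (2 * k)
                                       (2 * m + 1) (2 * n + 1)))
      \/ (exists j k m n : nat,
         graph_iso G (monomial_graph R (2 * j + 1) (2 * k + 1)
                                       (2 * m + 1) (2 * n + 1))))
   /\
   (has_girth G 6 <->
      [/\ ~~ odd s, ~~ odd t, odd u & odd v]
      \/ [/\ odd s, odd t, ~~ odd u & ~~ odd v]
      \/ [/\ odd s, odd t, odd u & odd v]
      \/ [/\ ~~ odd s, odd t, odd u, odd v & t <> v \/ s < u]
      \/ [/\ ~~ odd t, odd s, odd u, odd v & s <> u \/ t < v]
      \/ [/\ ~~ odd u, odd s, odd t, odd v & t <> v \/ u < s]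
      \/ [/\ ~~ odd v, odd s, odd t, odd u & s <> u \/ v < t]))
  /\
  ((has_girth G 8 <->
      exists k n : nat, 1 <= n /\ k < n /\
        graph_iso G (monomial_graph R 1 (2 * k + 1) 1 (2 * n)))
   /\
   (has_girth G 8 <->
      ([/\ ~~ odd s, odd t, odd u & odd v] /\ t = v /\ u < s)
      \/ ([/\ ~~ odd t, odd s, odd u & odd v] /\ s = u /\ v < t)
      \/ ([/\ ~~ odd u, odd s, odd t & odd v] /\ t = v /\ s < u)
      \/ ([/\ ~~ odd v, odd s, odd t & odd u] /\ s = u /\ t < v))).
Proof.
move=> G; have H6 := monomial_graph_girth6 R hs ht hu hv.
have H8 := monomial_graph_girth8 R hs ht hu hv.
split; first by rewrite /G Gamma_girth4; exact: monomial_graph_cycle4.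
split; split=> //.
- split=> [/H6|]; first exact: girth6_exponents_iso.
  (* Girth is invariant under isomorphism, so the exponents of the normal form decide. *)
  case=> [[j [k [m [n [n0 [h i]]]]]]|[[j [k [m [n [j0 [k0 i]]]]]]|[j [k [m [n i]]]]]];
  apply: (graph_iso_girth (graph_iso_sym i)); apply/monomial_graph_girth6; try lia.
  + by do 6 right; split; lia.
  + by left; split; lia.
  by right; right; left; split; lia.
split=> [/H8/girth8_exponents_iso-/(_ R)[s' [t' [v' [os ot ev tv i]]]]|].
  exists t'./2, v'./2; rewrite half_odd // half_even //; split; first lia.
  split; first lia.
  (* The substitution [a -> a^s'] turns the common odd exponent into 1. *)
  exact: graph_iso_trans i (monomial_graph_odd_root R t' v' os).
case=> k [n [n0 [kn i]]]; apply: (graph_iso_girth (graph_iso_sym i)).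
by apply/monomial_graph_girth8; try lia; do 3 right; split; [split|]; lia.
Qed.
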